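(* Let $(M_1,\omega_1)$ and $(M_2,\omega_2)$ be symplectic manifolds of dimension greater than zero, and let $(M,\omega)=(M_1,\omega_1)\times(M_2,\omega_2)$ be their product. Let $\nabla=\nabla_1+\nabla_2$ be a symplectic connection on $(M,\omega)$, i.e. the product connection of symplectic connections $\nabla_i$ on $(M_i,\omega_i)$, $i=1,2$. If $W^\nabla=0$, then $\nabla$, $\nabla_1$ and $\nabla_2$ are flat (their curvature tensors vanish identically).
   Context: A symplectic connection on a symplectic manifold $(M,\omega)$ is a linear connection $\nabla$ on $TM$ with vanishing torsion and $\nabla\omega=0$. Let $R$ be its curvature tensor and $\dim M=2n$. Its Ricci tensor is $r(X,Y)=\mathrm{Tr}(Z\mapsto R(X,Z)Y)$, which is symmetric; the associated endomorphism $A$ of $TM$ is defined by $r(X,Y)=\omega(X,AY)$. The tensor $W=W^\nabla$ is the irreducible component of the curvature complementary to the Ricci part, i.e. $$W(X,Y)Z=R(X,Y)Z-\frac{1}{2(n+1)}\Bigl[2\omega(X,Y)AZ+\omega(X,Z)AY-\omega(Y,AZ)X-\omega(Y,Z)AX+\omega(X,AZ)Y\Bigr]$$ for all vector fields $X,Y,Z$. Thus $W^\nabla=0$ means that $R$ is equal to $\frac{1}{2(n+1)}$ times the bracket above. On the product $M=M_1\times M_2$, the tangent bundle splits as $TM_1\oplus TM_2$ and $\omega$ is the sum of the pull-backs of $\omega_1$ and $\omega_2$. *)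

(* Defs.v *)
From HB Require Import structures.
From mathcomp Require Import all_boot all_order all_algebra.
From mathcomp Require Import all_classical all_reals all_analysis.

Set Implicit Arguments.
Unset Strict Implicit.
Unset Printing Implicit Defensive.

Import Order.TTheory GRing.Theory Num.Theory.
Import numFieldNormedType.Exports.

Local Open Scope classical_set_scope.
Local Open Scope ring_scope.

(* Smooth manifolds are topological spaces with a smooth atlas. Following the
   usual preferred-chart model, the tangent space at p is the model space
   'rV[R]_m, a vector being identified with its coordinates in the chart
   [chart_at p]; a vector field on a manifold with carrier T is then a function
   T -> 'rV[R]_m, whose coordinates in an arbitrary chart are obtained through
   the differentials of the changes of charts. Vector fields and functions are
   total but are only ever required to be smooth on some open set. *)

Section Smooth.
Context (R : realType) (V W : normedModType R).

(* Only meaningful on an open set D. When V is finite-dimensional, the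
   derivative is C^k if and only if all its evaluations at fixed vectors are. *)
Fixpoint is_Ck (k : nat) (D : set V) (f : V -> W) : Prop :=
  if k is k'.+1 then
    (forall x, D x -> differentiable f x) /\
    (forall v, is_Ck k' D (fun x => 'd f x v))
  else forall x, D x -> {for x, continuous f}.

Definition smooth_on (D : set V) (f : V -> W) : Prop := forall k, is_Ck k D f.

End Smooth.

(* [param i] is the inverse of the chart [coord i]; the values of [coord i]
   outside [dom i] and of [param i] outside the image of [dom i] are junk. *)
Record atlas (R : realType) (m : nat) (T : topologicalType) := Atlas {
  chart : Type;
  dom : chart -> set T;
  coord : chart -> T -> 'rV[R]_m;
  param : chart -> 'rV[R]_m -> T;
  chart_at : T -> chart
}.

Section Manifold.
Context (R : realType) (m : nat) (T : topologicalType) (M : atlas R m T).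
Implicit Types (i j : chart M) (p q : T) (U : set T) (f : T -> R).

Definition chart_image i U : set 'rV[R]_m := coord i @` (dom i `&` U).

Definition transition i j : 'rV[R]_m -> 'rV[R]_m := coord j \o param i.

Record smooth_manifold : Prop := SmoothManifold {
  manifold_nonempty : [set: T] !=set0;
  manifold_hausdorff : hausdorff_space T;
  manifold_second_countable : @second_countable T;
  dom_open : forall i, open (dom i);
  dom_chart_at : forall p, dom (chart_at M p) p;
  chart_image_open : forall i, open (chart_image i setT);
  coordK : forall i p, dom i p -> param i (coord i p) = p;
  coord_continuous : forall i p, dom i p -> {for p, continuous (@coord R m T M i)};
  param_continuous : forall i x, chart_image i setT x ->
    {for x, continuous (@param R m T M i)};
  transition_smooth : forall i j,
    smooth_on (chart_image i (dom j)) (transition i j)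
}.

Definition smooth_fun U f : Prop :=
  forall i, smooth_on (chart_image i U) (f \o param i).

Definition smooth_fun_at p f : Prop :=
  exists U, [/\ open U, U p & smooth_fun U f].

(* v(f), for v in T_p M *)
Definition tangent_deriv p (v : 'rV[R]_m) f : R :=
  'd (f \o param (chart_at M p)) (coord (chart_at M p) p) v.

(* the coordinates in the chart i of v in T_p M *)
Definition tangent_coord i p (v : 'rV[R]_m) : 'rV[R]_m :=
  'd (transition (chart_at M p) i) (coord (chart_at M p) p) v.

(* the vector of T_p M with coordinates u in the chart i *)
Definition tangent_vec i p (u : 'rV[R]_m) : 'rV[R]_m :=
  'd (transition i (chart_at M p)) (coord i p) u.

Implicit Types X Y Z : T -> 'rV[R]_m.

Definition field_rep i X : 'rV[R]_m -> 'rV[R]_m :=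
  fun x => tangent_coord i (param i x) (X (param i x)).

Definition smooth_field U X : Prop :=
  forall i, smooth_on (chart_image i U) (field_rep i X).

Definition smooth_field_at p X : Prop :=
  exists U, [/\ open U, U p & smooth_field U X].

(* X^a d_a Y^b - Y^a d_a X^b in the preferred chart at p *)
Definition lie_bracket X Y : T -> 'rV[R]_m := fun p =>
  let i := chart_at M p in
  'd (field_rep i Y) (coord i p) (X p) - 'd (field_rep i X) (coord i p) (Y p).

(* Differential 2-forms. Smoothness and closedness are tested on vector fields
   defined on open sets; the last condition is Cartan's formula for d w. *)
Definition symplectic_form (w : T -> 'rV[R]_m -> 'rV[R]_m -> R) : Prop :=
  [/\ forall p u, scalar (w p u) /\ scalar (w p ^~ u),
      forall p u, w p u u = 0,
      forall p u, (forall v, w p u v = 0) -> u = 0,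
      forall U X Y, open U -> smooth_field U X -> smooth_field U Y ->
        smooth_fun U (fun p => w p (X p) (Y p)) &
      forall p X Y Z,
        smooth_field_at p X -> smooth_field_at p Y -> smooth_field_at p Z ->
        tangent_deriv p (X p) (fun q => w q (Y q) (Z q))
        + tangent_deriv p (Y p) (fun q => w q (Z q) (X q))
        + tangent_deriv p (Z p) (fun q => w q (X q) (Y q))
        - w p (lie_bracket X Y p) (Z p)
        - w p (lie_bracket Y Z p) (X p)
        - w p (lie_bracket Z X p) (Y p) = 0].

Definition symplectic_manifold (w : T -> 'rV[R]_m -> 'rV[R]_m -> R) : Prop :=
  smooth_manifold /\ symplectic_form w.

(* [nabla p v Y] is the covariant derivative at p, in the direction v in T_p M,
   of a vector field Y smooth near p (and junk for other Y). The Leibniz rule,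
   for f smooth near p only, makes it depend on nothing but the germ of Y at p,
   so that this is the same as an operator on global vector fields. *)
Section Connection.
Variable nabla : T -> 'rV[R]_m -> (T -> 'rV[R]_m) -> 'rV[R]_m.

Definition cov X Y : T -> 'rV[R]_m := fun p => nabla p (X p) Y.

Definition linear_connection : Prop :=
  [/\ forall p Y, smooth_field_at p Y -> linear (fun v => nabla p v Y),
      forall p v Y Z, smooth_field_at p Y -> smooth_field_at p Z ->
        nabla p v (fun q => Y q + Z q) = nabla p v Y + nabla p v Z,
      forall p v f Y, smooth_fun_at p f -> smooth_field_at p Y ->
        nabla p v (fun q => f q *: Y q)
          = tangent_deriv p v f *: Y p + f p *: nabla p v Y &
      forall U X Y, open U -> smooth_field U X -> smooth_field U Y ->
        smooth_field U (cov X Y)].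

Definition torsion_free : Prop :=
  forall p X Y, smooth_field_at p X -> smooth_field_at p Y ->
    cov X Y p - cov Y X p - lie_bracket X Y p = 0.

Definition parallel_form (w : T -> 'rV[R]_m -> 'rV[R]_m -> R) : Prop :=
  forall p X Y Z,
    smooth_field_at p X -> smooth_field_at p Y -> smooth_field_at p Z ->
    tangent_deriv p (X p) (fun q => w q (Y q) (Z q))
      - w p (cov X Y p) (Z p) - w p (Y p) (cov X Z p) = 0.

Definition symplectic_connection (w : T -> 'rV[R]_m -> 'rV[R]_m -> R) : Prop :=
  [/\ linear_connection, torsion_free & parallel_form w].

Definition curvature X Y Z : T -> 'rV[R]_m := fun p =>
  cov X (cov Y Z) p - cov Y (cov X Z) p - cov (lie_bracket X Y) Z p.

Definition flat : Prop :=
  forall p X Y Z,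
    smooth_field_at p X -> smooth_field_at p Y -> smooth_field_at p Z ->
    curvature X Y Z p = 0.

(* the field with constant coordinates in the preferred chart at p, extending
   the vector v in T_p M *)
Definition extend_vec p (v : 'rV[R]_m) : T -> 'rV[R]_m :=
  fun q => tangent_vec (chart_at M p) q v.

(* R_p(x,y)z, well defined since the curvature is a tensor *)
Definition curvature_at p (x y z : 'rV[R]_m) : 'rV[R]_m :=
  curvature (extend_vec p x) (extend_vec p y) (extend_vec p z) p.

Definition ricci p (x y : 'rV[R]_m) : R :=
  \tr (lin1_mx (fun z => curvature_at p x z y)).

(* the vector A y with r(x, y) = w(x, A y) for all x in T_p M, which exists and
   is unique by nondegeneracy of w *)
Definition ricci_endo (w : T -> 'rV[R]_m -> 'rV[R]_m -> R) p (y : 'rV[R]_m)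
    : 'rV[R]_m :=
  get [set a | forall x, ricci p x y = w p x a].

(* with dim M = m = 2n *)
Definition weyl (w : T -> 'rV[R]_m -> 'rV[R]_m -> R) X Y Z : T -> 'rV[R]_m :=
  fun p =>
  let n := m./2 in
  let A := ricci_endo w p in
  let '(x, y, z) := (X p, Y p, Z p) in
  curvature X Y Z p
  - (2 * (n%:R + 1))^-1 *:
      (2 * w p x y *: A z + w p x z *: A y - w p y (A z) *: x
       - w p y z *: A x + w p x (A z) *: y).

Definition weyl_zero (w : T -> 'rV[R]_m -> 'rV[R]_m -> R) : Prop :=
  forall p X Y Z,
    smooth_field_at p X -> smooth_field_at p Y -> smooth_field_at p Z ->
    weyl w X Y Z p = 0.

End Connection.
End Manifold.

Section Product.
Context (R : realType) (m1 m2 : nat) (T1 T2 : topologicalType).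

(* With these preferred charts, the tangent space at (p1, p2) is
   'rV[R]_(m1 + m2), split as T_p1 M1 + T_p2 M2 by [lsubmx] and [rsubmx]. *)
Definition prod_atlas (M1 : atlas R m1 T1) (M2 : atlas R m2 T2) :
    atlas R (m1 + m2) (T1 * T2)%type :=
  {| chart := (chart M1 * chart M2)%type;
     dom := fun i => dom i.1 `*` dom i.2;
     coord := fun i p => row_mx (coord i.1 p.1) (coord i.2 p.2);
     param := fun i x => (param i.1 (lsubmx x), param i.2 (rsubmx x));
     chart_at := fun p => (chart_at M1 p.1, chart_at M2 p.2) |}.

Definition prod_form (w1 : T1 -> 'rV[R]_m1 -> 'rV[R]_m1 -> R)
    (w2 : T2 -> 'rV[R]_m2 -> 'rV[R]_m2 -> R)
    (p : T1 * T2) (u v : 'rV[R]_(m1 + m2)) : R :=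
  w1 p.1 (lsubmx u) (lsubmx v) + w2 p.2 (rsubmx u) (rsubmx v).

(* the field Y1 + Y2 on the product *)
Definition prod_field (Y1 : T1 -> 'rV[R]_m1) (Y2 : T2 -> 'rV[R]_m2)
    (p : T1 * T2) : 'rV[R]_(m1 + m2) :=
  row_mx (Y1 p.1) (Y2 p.2).

(* nabla = nabla1 + nabla2; a linear connection on the product is determined by
   its values on the fields Y1 + Y2, since these contain local frames *)
Definition product_connection (M1 : atlas R m1 T1) (M2 : atlas R m2 T2)
    (nabla1 : T1 -> 'rV[R]_m1 -> (T1 -> 'rV[R]_m1) -> 'rV[R]_m1)
    (nabla2 : T2 -> 'rV[R]_m2 -> (T2 -> 'rV[R]_m2) -> 'rV[R]_m2)
    (nabla : T1 * T2 -> 'rV[R]_(m1 + m2) ->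
             (T1 * T2 -> 'rV[R]_(m1 + m2)) -> 'rV[R]_(m1 + m2)) : Prop :=
  forall p v Y1 Y2,
    smooth_field_at M1 p.1 Y1 -> smooth_field_at M2 p.2 Y2 ->
    nabla p v (prod_field Y1 Y2)
      = row_mx (nabla1 p.1 (lsubmx v) Y1) (nabla2 p.2 (rsubmx v) Y2).

End Product.

(* Main.v *)
(** Locally the curvature of the product connection is R = R1 + R2, so it
    vanishes on (X, Y) with X tangent to M1 and Y tangent to M2. Equating the
    Ricci expression of R to zero on such pairs forces A = l on TM1 and A = - l
    on TM2 for some scalar l at each point. Taking the trace of the Ricci
    expression then gives (n + 1) l = 2 n1 l and (n + 1) l = 2 n2 l, where
    2 n1 = dim M1, 2 n2 = dim M2 and n = n1 + n2; as 2 n1 = 2 n2 = n + 1 would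
    give 2 n = 2 n + 2, it follows that l = 0, hence A = 0 and R = 0. *)

Require Import Defs.
From HB Require Import structures.
From mathcomp Require Import all_boot all_order all_algebra.
From mathcomp Require Import all_classical all_reals all_analysis.
From mathcomp Require Import zify ring lra.
(* [vector] also has a [coord], [matrix_normedtype] a [coord_continuous]. *)
Import Defs.

Set Implicit Arguments.
Unset Strict Implicit.
Unset Printing Implicit Defensive.

Import Order.TTheory GRing.Theory Num.Theory.
Import numFieldNormedType.Exports.

(** [ricci_endo] is a choice made by [get]: before a representing vector is known to exist, A is a
    bare function, neither linear nor related to the Ricci tensor. This dictates the order of the
    argument. The mixed pairs give the block form diag(l, -l) for an arbitrary function A; with it
    the Ricci trace is an explicit w(x, ...), which exhibits a representing vector; only then does
    the defining property of A become available, as a fixed-point equation. Behind the numerical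
    contradiction: the Ricci constant is tuned to an A that is skew for w, for which the trace of
    the bracket is (2n + 2) w(x, Ay), whereas diag(l, -l) is self-adjoint for w and yields 2n w(x,
    Ay) + tr(A) w(x, y). The product connection is known on fields Y1 + Y2 only, and covariant
    derivatives of such fields have this shape only near the point considered, hence the recourse to
    locality. Since W = 0 gives the curvature of all smooth fields pointwise, testing on product
    fields and on [extend_vec] suffices. *)

Section Calculus.
Local Open Scope classical_set_scope.
Local Open Scope ring_scope.
Context (R : realType).

(** * Germs, sums and products of C^k maps *)

Section General.
Context (V W : normedModType R).
Implicit Types (f g : V -> W) (x : V) (D : set V).

(** The first-order expansion of [f] at [x] is also one for [g], and [diff_unique] identifies the
    differential. Charts carry junk values off their domains, so most identities hold only near a
    point and must be differentiated as germs. *)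
Lemma near_eq_diff f g x : differentiable f x ->
  (\forall y \near x, f y = g y) ->
  differentiable g x /\ 'd g x = 'd f x :> (V -> W).
Proof.
move=> df fg; have fgx : f x = g x by exact: nbhs_singleton fg.
have E : g \o shift x = cst (g x) + 'd f x +o_ 0 id.
  apply/eqaddoP => e e0.
  have := diff_locally df; move/eqaddoP => /(_ e e0) H.
  have fg0 : \forall h \near (0 : V), f (h + x) = g (h + x).
    by move/nbhs0P: fg; apply: filterS => h; rewrite addrC.
  apply: filterS2 fg0 H => h fgh; apply: le_trans.
  by rewrite !fctE /= fgh fgx.
have dE : 'd g x = 'd f x :> (V -> W).
  by apply: diff_unique => //; exact: diff_continuous.
split=> //; apply/diff_locallyP; rewrite dE; split=> //.
exact: diff_continuous.
Qed.

Lemma open_eq_diff f g D x : open D -> D x -> (forall y, D y -> f y = g y) ->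
  differentiable f x -> differentiable g x /\ 'd g x = 'd f x :> (V -> W).
Proof.
move=> oD Dx fg df; apply: near_eq_diff df _.
by near=> y; apply: fg; near: y; exact: open_nbhs_nbhs.
Unshelve. all: by end_near. Qed.

Lemma eq_is_Ck k D f g : open D -> (forall x, D x -> f x = g x) ->
  is_Ck k D f -> is_Ck k D g.
Proof.
elim: k f g => [|k IH] f g oD fg /=.
  move=> cf x Dx; rewrite /prop_for /continuous_at -(fg x Dx).
  apply: cvg_trans (cf x Dx); apply: near_eq_cvg; near=> y; apply: fg.
  near: y; exact: open_nbhs_nbhs.
move=> [df Ck]; split=> [x Dx|v].
  by have [] := open_eq_diff oD Dx fg (df x Dx).
apply: (IH (fun x => 'd f x v) _ oD _ (Ck v)) => x Dx.
have [_ E] := open_eq_diff oD Dx fg (df x Dx).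
exact: esym (congr1 (@^~ v) E).
Unshelve. all: by end_near. Qed.

Lemma sub_is_Ck k D D' f : D `<=` D' -> is_Ck k D' f -> is_Ck k D f.
Proof.
elim: k f => [|k IH] f DD /=; first by move=> cf x /DD; exact: cf.
by move=> [df Ck]; split=> [x /DD|v]; [exact: df|exact: IH].
Qed.

(** The recursion defining [is_Ck] does not record lower orders; the product and chain rules need
    them for their undifferentiated factors. *)
Lemma is_CkS k D f : is_Ck k.+1 D f -> is_Ck k D f.
Proof.
elim: k f => [|k IH] f [df Ck] /=.
  by move=> x Dx; apply: differentiable_continuous; exact: df.
by split=> // v; apply: IH (Ck v).
Qed.

Lemma is_Ck_cst k D (c : W) : is_Ck k D (fun=> c).
Proof.
elim: k c => [|k IH] c /=; first by move=> x _; exact: cvg_cst.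
split=> [x _|v]; first exact: differentiable_cst.
suff -> : (fun x => 'd (fun=> c) x v) = (fun=> 0 : W) by exact: IH.
by apply/funext => x; rewrite (diff_cst c x).
Qed.

Lemma is_CkD k D f g : open D -> is_Ck k D f -> is_Ck k D g ->
  is_Ck k D (fun x => f x + g x).
Proof.
elim: k f g => [|k IH] f g oD /=.
  by move=> cf cg x Dx; apply: cvgD; [exact: cf|exact: cg].
move=> [df Cf] [dg Cg]; split=> [x Dx|v].
  by apply: differentiableD; [exact: df|exact: dg].
apply: eq_is_Ck (IH _ _ oD (Cf v) (Cg v)) => // x Dx /=.
exact: esym (congr1 (@^~ v) (diffD (df _ Dx) (dg _ Dx))).
Qed.

Lemma is_Ck_sum k D (I : Type) (r : seq I) (f : I -> V -> W) : open D ->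
  (forall i, is_Ck k D (f i)) -> is_Ck k D (fun x => \sum_(i <- r) f i x).
Proof.
move=> oD Cf; elim: r => [|i r IH].
  by rewrite (_ : (fun x => _) = fun=> 0); [exact: is_Ck_cst|
     apply/funext => x; rewrite big_nil].
rewrite (_ : (fun x => _) = fun x => f i x + \sum_(i <- r) f i x).
  exact: is_CkD.
by apply/funext => x; rewrite big_cons.
Qed.

Lemma scale_is_bilinear :
  bilinear_for
    (GRing.Scale.Law.clone _ _ *:%R _) (GRing.Scale.Law.clone _ _ *:%R _)
    (@GRing.scale R W).
Proof.
split=> [w|a] b x y /=; first by rewrite scalerDl scalerA.
by rewrite scalerDr !scalerA mulrC.
Qed.

Lemma diff_scale (a : V -> R) f x : differentiable a x -> differentiable f x ->
  differentiable (fun y => a y *: f y) x /\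
  'd (fun y => a y *: f y) x = (fun v => a x *: 'd f x v + 'd a x v *: f x)
    :> (V -> W).
Proof.
move=> da df.
(* Scaling is packed as a bilinear map, so that the Leibniz rule becomes the differential of a
   bilinear map composed with a pair. *)
pose sM := bilinear_isBilinear.Build R R W W _ _
  (@GRing.scale R W) scale_is_bilinear.
pose s : {bilinear R -> W -> W} := HB.pack (@GRing.scale R W) sM.
have sc : continuous (fun p : R * W => s p.1 p.2).
  by move=> p; exact: scale_continuous.
have -> : (fun y => a y *: f y) =
   (fun p : R * W => s p.1 p.2) \o (fun y => (a y, f y)) by [].
have dp := differentiable_pair da df.
have ds : differentiable (fun p : R * W => s p.1 p.2) (a x, f x).
  exact: differentiable_bilin.
split; first exact: differentiable_comp.
by rewrite diff_comp // diff_pair // diff_bilin.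
Qed.

End General.

Lemma is_Ck_scale (V W : normedModType R) k (D : set V) (a : V -> R) (f : V -> W) :
  open D -> is_Ck k D a -> is_Ck k D f ->
  is_Ck k D (fun x => a x *: f x).
Proof.
elim: k a f => [|k IH] a f oD Ca Cf.
  by move=> x Dx; apply: cvgZ; [exact: Ca|exact: Cf].
have [da Ca'] := Ca; have [df Cf'] := Cf.
split=> [x Dx|v].
  by have [] := diff_scale (da _ Dx) (df _ Dx).
have Ca1 := is_CkS Ca; have Cf1 := is_CkS Cf.
apply: eq_is_Ck (is_CkD oD (IH _ _ oD Ca1 (Cf' v)) (IH _ _ oD (Ca' v) Cf1)) => //.
move=> x Dx; have [_ E] := diff_scale (da _ Dx) (df _ Dx).
exact: esym (congr1 (@^~ v) E).
Qed.

(** * Composition of C^k maps *)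

Section Linear.
Context (U V W : normedModType R).

Lemma is_Ck_post_linear k (D : set U) (f : U -> V) (L : {linear V -> W}) :
  open D -> continuous L -> is_Ck k D f -> is_Ck k D (L \o f).
Proof.
move=> oD cL; elim: k f => [|k IH] f /=.
  by move=> cf x Dx; apply: continuous_comp; [exact: cf|exact: cL].
move=> [df Cf]; split=> [x Dx|v].
  by apply: differentiable_comp; [exact: df|exact: linear_differentiable].
apply: eq_is_Ck (IH _ (Cf v)) => // x Dx.
rewrite (diff_comp (df _ Dx) (linear_differentiable _ cL)).
by rewrite /= diff_lin.
Qed.

Lemma is_Ck_pre_linear k (D : set U) (E : set V) (f : V -> W)
    (L : {linear U -> V}) : open D -> continuous L -> D `<=` L @^-1` E ->
  is_Ck k E f -> is_Ck k D (f \o L).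
Proof.
move=> oD cL DE; elim: k f => [|k IH] f /=.
  by move=> cf x Dx; apply: continuous_comp; [exact: cL|exact: cf (DE _ Dx)].
move=> [df Cf]; split=> [x Dx|v].
  apply: differentiable_comp; [exact: linear_differentiable|exact: df (DE _ Dx)].
apply: eq_is_Ck (IH _ (Cf (L v))) => // x Dx.
rewrite (diff_comp (linear_differentiable _ cL) (df _ (DE _ Dx))).
by rewrite /= diff_lin.
Qed.

End Linear.

(** [is_Ck] tests derivatives at fixed vectors, while the chain rule evaluates ['d g (f x)] at the
    moving vector ['d f x v]. Expanding that vector in the standard basis gives a sum of scalar
    functions times derivatives of [g] at fixed vectors, to which the product rule and the induction
    apply; this is why the middle space is a space of row vectors. *)
Lemma is_Ck_comp (V W : normedModType R) n k (D : set V) (E : set 'rV[R]_n)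
    (f : V -> 'rV[R]_n) (g : 'rV[R]_n -> W) :
  open D -> D `<=` f @^-1` E -> is_Ck k D f -> is_Ck k E g ->
  is_Ck k D (g \o f).
Proof.
move=> oD DE; elim: k g => [|k IH] g Cf Cg.
  by move=> x Dx; apply: continuous_comp; [exact: Cf|exact: Cg (DE _ Dx)].
have [df Cf'] := Cf; have [dg Cg'] := Cg.
split=> [x Dx|v].
  by apply: differentiable_comp; [exact: df|exact: dg (DE _ Dx)].
have Cj j : is_Ck k D
    (fun x => ('d f x v : 'rV[R]_n) 0 j *: 'd g (f x) (delta_mx 0 j)).
  apply: (is_Ck_scale oD); last exact: IH (is_CkS Cf) (Cg' _).
  have lc : linear (fun M : 'rV[R]_n => M 0 j : R).
    by move=> a M N; rewrite !mxE.
  pose c : {linear 'rV[R]_n -> R} := HB.pack (fun M : 'rV[R]_n => M 0 j : R)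
    (GRing.isLinear.Build _ _ _ _ _ lc).
  have cc : continuous c by exact: matrix_normedtype.coord_continuous.
  exact: (is_Ck_post_linear oD cc (Cf' v)).
apply: eq_is_Ck (is_Ck_sum (index_enum 'I_n) oD Cj) => // x Dx.
rewrite (diff_comp (df _ Dx) (dg _ (DE _ Dx))).
rewrite /= [in RHS](row_sum_delta ('d f x v)) linear_sum.
by apply: eq_bigr => j _; rewrite linearZ.
Qed.

End Calculus.

(** * Block maps between spaces of row vectors *)

Section Block.
Local Open Scope classical_set_scope.
Local Open Scope ring_scope.
Context (R : realType).

(** Such a map is a finite sum of coordinates times images of basis vectors, so its continuity is
    the case [k = 0] of the calculus above. *)
Lemma rV_linear_continuous n (W : normedModType R)
  (L : {linear 'rV[R]_n -> W}) : continuous L.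
Proof.
have Ck : is_Ck 0 setT
    (fun u : 'rV[R]_n => \sum_(j <- index_enum 'I_n) u 0 j *: L (delta_mx 0 j)).
  apply: is_Ck_sum; first exact: openT.
  move=> j x _.
  have cj : (fun u : 'rV[R]_n => u 0 j : R) @ x --> (x 0 j : R).
    exact: matrix_normedtype.coord_continuous.
  exact: (cvgZ cj (cvg_cst (L (delta_mx 0 j)))).
rewrite (_ : (fun u => _) = L :> (_ -> _)) in Ck; first by move=> x; exact: Ck x I.
apply/funext => u; rewrite [in RHS](row_sum_delta u) linear_sum.
by apply: eq_bigr => j _; rewrite linearZ.
Qed.

Context (m1 m2 : nat).

(** With these two linear embeddings a block map is a sum of maps composed with linear ones on both
    sides, so no separate calculus for [row_mx] is required. *)
Definition row_inl (u : 'rV[R]_m1) : 'rV[R]_(m1 + m2) := row_mx u 0.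
Definition row_inr (u : 'rV[R]_m2) : 'rV[R]_(m1 + m2) := row_mx 0 u.

Lemma row_inl_is_linear : linear row_inl.
Proof. by move=> a u v; rewrite /row_inl scale_row_mx add_row_mx scaler0 addr0. Qed.

Lemma row_inr_is_linear : linear row_inr.
Proof. by move=> a u v; rewrite /row_inr scale_row_mx add_row_mx scaler0 addr0. Qed.

HB.instance Definition _ := GRing.isLinear.Build _ _ _ _ _ row_inl_is_linear.
HB.instance Definition _ := GRing.isLinear.Build _ _ _ _ _ row_inr_is_linear.

Lemma row_mxE_inlr u v : row_mx u v = row_inl u + row_inr v.
Proof. by rewrite /row_inl /row_inr add_row_mx addr0 add0r. Qed.

Context (n1 n2 : nat).

Definition block_fun (f : 'rV[R]_m1 -> 'rV[R]_n1) (g : 'rV[R]_m2 -> 'rV[R]_n2)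
  (x : 'rV[R]_(m1 + m2)) : 'rV[R]_(n1 + n2) := row_mx (f (lsubmx x)) (g (rsubmx x)).

End Block.

Section LinearDiff.
Local Open Scope ring_scope.
Context (R : realType) (U V W : normedModType R).

Lemma diff_post_linear (L : {linear V -> W}) (f : U -> V) x :
  continuous L -> differentiable f x ->
  differentiable (L \o f) x /\ forall v, 'd (L \o f) x v = L ('d f x v).
Proof.
move=> cL df; have dL := linear_differentiable (f x) cL.
split=> [|v]; first exact: differentiable_comp.
have := congr1 (@^~ v) (diff_comp df dL); move=> /= ->.
exact: (congr1 (@^~ _) (diff_lin (f x) cL)).
Qed.

Lemma diff_pre_linear (L : {linear U -> V}) (f : V -> W) x :
  continuous L -> differentiable f (L x) ->
  differentiable (f \o L) x /\ forall v, 'd (f \o L) x v = 'd f (L x) (L v).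
Proof.
move=> cL df; have dL := linear_differentiable x cL.
split=> [|v]; first exact: differentiable_comp.
have := congr1 (@^~ v) (diff_comp dL df); move=> /= ->; congr ('d f (L x) _).
exact: (congr1 (@^~ _) (diff_lin x cL)).
Qed.

End LinearDiff.

Section BlockCalculus.
Local Open Scope classical_set_scope.
Local Open Scope ring_scope.
Context (R : realType) (m1 m2 n1 n2 : nat).
Implicit Types (f : 'rV[R]_m1 -> 'rV[R]_n1) (g : 'rV[R]_m2 -> 'rV[R]_n2).

Lemma block_funE f g : block_fun f g =
  ((@row_inl R n1 n2 \o (f \o lsubmx)) : _ -> _) + (@row_inr R n1 n2 \o (g \o rsubmx)).
Proof. by apply/funext => x; rewrite /block_fun row_mxE_inlr. Qed.

Lemma diff_block f g (x : 'rV[R]_(m1 + m2)) :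
  differentiable f (lsubmx x) -> differentiable g (rsubmx x) ->
  differentiable (block_fun f g) x /\
  'd (block_fun f g) x = block_fun ('d f (lsubmx x)) ('d g (rsubmx x))
    :> ('rV[R]_(m1 + m2) -> 'rV[R]_(n1 + n2)).
Proof.
move=> df dg.
have cl := @rV_linear_continuous R _ _ (@row_inl R n1 n2).
have cr := @rV_linear_continuous R _ _ (@row_inr R n1 n2).
have csl := @continuous_lsubmx R 1 m1 m2.
have csr := @continuous_rsubmx R 1 m1 m2.
have [df1 dfE] := diff_pre_linear csl df.
have [dg1 dgE] := diff_pre_linear csr dg.
have [df2 df2E] := diff_post_linear cl df1.
have [dg2 dg2E] := diff_post_linear cr dg1.
have E := esym (block_funE f g).
have [dE dEE] := near_eq_diff (differentiableD df2 dg2)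
  (filterE _ (fun x => congr1 (@^~ x) E)).
split; [exact: dE|apply/funext => v].
apply: (etrans (congr1 (@^~ v) dEE)).
apply: (etrans (congr1 (@^~ v) (diffD df2 dg2))).
apply: (etrans (congr2 +%R (df2E v) (dg2E v))).
apply: (etrans (congr2 (fun a b => row_inl _ a + row_inr _ b) (dfE v) (dgE v))).
exact: esym (row_mxE_inlr _ _).
Qed.

Definition block_set (D1 : set 'rV[R]_m1) (D2 : set 'rV[R]_m2) :
  set 'rV[R]_(m1 + m2) := (lsubmx @^-1` D1) `&` (rsubmx @^-1` D2).

Lemma open_block_set D1 D2 : open D1 -> open D2 -> open (block_set D1 D2).
Proof.
move=> o1 o2; apply: openI.
  by apply: open_comp => // x _; exact: continuous_lsubmx.
by apply: open_comp => // x _; exact: continuous_rsubmx.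
Qed.

Lemma is_Ck_block k D1 D2 f g : open D1 -> open D2 ->
  is_Ck k D1 f -> is_Ck k D2 g -> is_Ck k (block_set D1 D2) (block_fun f g).
Proof.
move=> o1 o2 Cf Cg; rewrite block_funE.
have oD := open_block_set o1 o2.
apply: is_CkD => //.
  apply: is_Ck_post_linear => //; first exact: rV_linear_continuous.
  apply: is_Ck_pre_linear Cf => //; last by move=> x [].
  exact: continuous_lsubmx.
apply: is_Ck_post_linear => //; first exact: rV_linear_continuous.
apply: is_Ck_pre_linear Cg => //; last by move=> x [].
exact: continuous_rsubmx.
Qed.

End BlockCalculus.

(** * Vector fields and connections on a single manifold *)

Section SmoothAtlas.
Local Open Scope classical_set_scope.
Local Open Scope ring_scope.

(* [smooth_manifold] minus the Hausdorff and countability conditions, so that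
   products need no argument about the topology. *)
Record smooth_atlas (R : realType) (m : nat) (T : topologicalType)
    (M : atlas R m T) : Prop := SmoothAtlas {
  atlas_dom_open : forall i : chart M, open (dom i);
  atlas_dom_chart_at : forall p, dom (chart_at M p) p;
  atlas_chart_image_open : forall i : chart M, open (chart_image i setT);
  atlas_coordK : forall (i : chart M) p, dom i p -> param i (coord i p) = p;
  atlas_coord_continuous : forall (i : chart M) p, dom i p ->
    {for p, continuous (@coord R m T M i)};
  atlas_param_continuous : forall (i : chart M) x, chart_image i setT x ->
    {for x, continuous (@param R m T M i)};
  atlas_transition_smooth : forall i j : chart M,
    smooth_on (chart_image i (dom j)) (transition i j)
}.

Lemma smooth_manifold_atlas (R : realType) (m : nat) (T : topologicalType)
  (M : atlas R m T) : smooth_manifold M -> smooth_atlas M.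
Proof. by case=> *; split. Qed.

Section Atlas.
Context (R : realType) (m : nat) (T : topologicalType) (M : atlas R m T).
Hypothesis sM : smooth_atlas M.
Implicit Types (i j : chart M) (p q : T) (U : set T) (X Y : T -> 'rV[R]_m).

Let paramK i p : dom i p -> param i (coord i p) = p := @atlas_coordK _ _ _ _ sM i p.

Lemma chart_imageP i U x :
  chart_image i U x <-> chart_image i setT x /\ U (param i x).
Proof.
split; first by move=> [q [dq Uq] <-]; rewrite paramK//; split=> //; exists q.
by move=> [[q [dq _] <-]]; rewrite paramK// => Uq; exists q.
Qed.

Lemma chart_image_param i U x : chart_image i U x ->
  [/\ dom i (param i x), U (param i x) & coord i (param i x) = x].
Proof. by move=> [q [dq Uq] <-]; rewrite paramK. Qed.

Lemma sub_chart_image i U V : U `<=` V -> chart_image i U `<=` chart_image i V.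
Proof. by move=> UV _ [q [dq /UV Vq] <-]; exists q. Qed.

Lemma coord_chart_image i U p : dom i p -> U p -> chart_image i U (coord i p).
Proof. by move=> dp Up; exists p. Qed.

Lemma chart_image_sub_open i U : open U -> open (chart_image i U).
Proof.
move=> oU; rewrite openE => x /chart_imageP [xi Ux]; rewrite /interior.
have H1 : \forall y \near x, chart_image i setT y.
  by apply: open_nbhs_nbhs; split=> //; exact: atlas_chart_image_open.
have H2 : \forall y \near x, U (param i y).
  apply: (atlas_param_continuous sM xi (t := U)).
  by apply: open_nbhs_nbhs; split.
by apply: filterS2 H1 H2 => y ? ?; apply/chart_imageP.
Qed.

Lemma eq_smooth_fun U (f g : T -> R) : open U -> (forall q, U q -> f q = g q) ->
  smooth_fun M U f -> smooth_fun M U g.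
Proof.
move=> oU fg sf i k; apply: eq_is_Ck (sf i k); first exact: chart_image_sub_open.
by move=> x /chart_image_param [_ Ux _]; exact: fg.
Qed.

Lemma smooth_fun_cst U (c : R) : smooth_fun M U (fun=> c).
Proof. by move=> i k; exact: is_Ck_cst. Qed.

Lemma tangent_deriv_locally_cst p v (f : T -> R) (c : R) U : open U -> U p ->
  (forall q, U q -> f q = c) -> tangent_deriv M p v f = 0.
Proof.
move=> oU Up fc; rewrite /tangent_deriv; set i := chart_at M p.
have dp : dom i p := atlas_dom_chart_at sM p.
have [|_ E] := open_eq_diff (chart_image_sub_open (i := i) oU) (coord_chart_image dp Up)
   _ (differentiable_cst c _) (g := f \o param i).
  by move=> y /chart_image_param [_ Uy _]; rewrite /= fc.
apply: (etrans (congr1 (@^~ v) E)).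
exact: (congr1 (@^~ v) (diff_cst c _)).
Qed.

Lemma eq_smooth_field U X Y : open U -> (forall q, U q -> X q = Y q) ->
  smooth_field M U X -> smooth_field M U Y.
Proof.
move=> oU XY sX i k; apply: eq_is_Ck (sX i k); first exact: chart_image_sub_open.
by move=> x /chart_image_param [_ Ux _]; rewrite /field_rep XY.
Qed.

Lemma sub_smooth_field U V X : V `<=` U -> smooth_field M U X ->
  smooth_field M V X.
Proof. by move=> VU sX i k; apply: sub_is_Ck (sX i k); exact: sub_chart_image. Qed.

Lemma smooth_field0 U : smooth_field M U (fun=> 0).
Proof.
move=> i k; rewrite (_ : field_rep i _ = fun=> 0); first exact: is_Ck_cst.
by apply/funext => x; rewrite /field_rep /tangent_coord linear0.
Qed.

Lemma smooth_field_at0 p : smooth_field_at M p (fun=> 0).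
Proof. by exists setT; split; [exact: openT| |exact: smooth_field0]. Qed.

Lemma smooth_field_atI p X Y :
  smooth_field_at M p X -> smooth_field_at M p Y ->
  exists U, [/\ open U, U p, smooth_field M U X & smooth_field M U Y].
Proof.
move=> [U [oU Up sX]] [V [oV Vp sY]]; exists (U `&` V); split=> //.
- exact: openI.
- by apply: sub_smooth_field sX => q [].
- by apply: sub_smooth_field sY => q [].
Qed.

Lemma differentiable_transition i j q : dom i q -> dom j q ->
  differentiable (transition i j) (coord i q).
Proof.
move=> di dj; have [d _] := atlas_transition_smooth sM i j 1%N.
exact: d (coord_chart_image di dj).
Qed.

(** Chain rule: on the part of chart [i] lying over [dom j], the composite
    [transition j k \o transition i j] agrees with [transition i k], because [param j] undoes
    [coord j] there. *)
Lemma transition_comp i j k q v : dom i q -> dom j q -> dom k q ->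
  'd (transition j k) (coord j q) ('d (transition i j) (coord i q) v) =
  'd (transition i k) (coord i q) v.
Proof.
move=> di dj dk.
have dij := differentiable_transition di dj.
have E : transition i j (coord i q) = coord j q by rewrite /transition /= paramK.
have djk : differentiable (transition j k) (transition i j (coord i q)).
  by rewrite E; exact: differentiable_transition.
have [_ H] := open_eq_diff (chart_image_sub_open (i := i) (atlas_dom_open sM j))
  (coord_chart_image di dj) (f := transition j k \o transition i j)
  (g := transition i k)
  (fun x H => let: And3 _ djx _ := chart_image_param H in
     congr1 (coord k) (paramK djx)) (differentiable_comp dij djk).
apply: esym; apply: (etrans (congr1 (@^~ v) H)).
apply: (etrans (congr1 (@^~ v) (diff_comp dij djk))).
by rewrite /= E.
Qed.

Lemma transition_id i q v : dom i q ->
  'd (transition i i) (coord i q) v = v.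
Proof.
move=> di.
have idd : differentiable (@id 'rV[R]_m) (coord i q) by apply: ex_diff.
have [_ H] := open_eq_diff (atlas_chart_image_open sM (i:=i))
  (coord_chart_image di I) (f := id) (g := transition i i)
  (fun x H => let: And3 _ _ E := chart_image_param H in esym E) idd.
apply: (etrans (congr1 (@^~ v) H)).
exact: (congr1 (@^~ v) (@diff_val _ _ _ _ _ _ _ (is_diff_id (coord i q)))).
Qed.

Lemma extend_vec_self p v : extend_vec M p v p = v.
Proof. exact: transition_id (atlas_dom_chart_at sM p). Qed.

(** By the cocycle rule, the field reads in a chart [j] as ['d (transition i j) y v] at
    [y = transition j i x], a composite of smooth maps. *)
Lemma smooth_extend_vec p v : smooth_field_at M p (extend_vec M p v).
Proof.
set i := chart_at M p; exists (dom i).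
split; [exact: atlas_dom_open|exact: atlas_dom_chart_at|].
move=> j k.
have oD := chart_image_sub_open (i := j) (atlas_dom_open sM i).
have Cg : is_Ck k (chart_image i (dom j)) (fun y => 'd (transition i j) y v).
  by have [_] := atlas_transition_smooth sM i j k.+1; exact.
have DE : chart_image j (dom i) `<=` transition j i @^-1` chart_image i (dom j).
  by move=> x /chart_image_param [dj di _]; exists (param j x).
apply: eq_is_Ck (is_Ck_comp oD DE (atlas_transition_smooth sM j i k) Cg) => //.
move=> x /chart_image_param [dj di _].
apply: esym; apply: transition_comp => //; exact: atlas_dom_chart_at.
Qed.

(** * Locality of a connection, and its curvature on zero fields *)

Section Connection.
Variable nabla : T -> 'rV[R]_m -> (T -> 'rV[R]_m) -> 'rV[R]_m.
Hypothesis nablaC : linear_connection M nabla.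

(* The Leibniz rule only asks f to be smooth near p, so it applies to the
   indicator function of a neighbourhood of p: no bump function is needed. *)
Lemma connection_local U p v X Y : open U -> U p ->
  (forall q, U q -> X q = Y q) -> smooth_field_at M p X ->
  nabla p v X = nabla p v Y.
Proof.
move=> oU Up XY sX; have [_ _ leibniz _] := nablaC.
have sY : smooth_field_at M p Y.
  have [V [oV Vp sXV]] := sX; exists (U `&` V); split=> //; first exact: openI.
  apply: (@eq_smooth_field _ X); first exact: openI.
    by move=> q [Uq _]; exact: XY.
  by apply: sub_smooth_field sXV => q [].
pose f q : R := \1_U q.
have f1 q : U q -> f q = 1 by move=> Uq; rewrite /f indicE mem_set.
have sf : smooth_fun_at M p f.
  exists U; split=> //; apply: eq_smooth_fun (smooth_fun_cst U 1) => // q Uq.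
  by rewrite f1.
have fE Z : smooth_field_at M p Z -> nabla p v (fun q => f q *: Z q) = nabla p v Z.
  move=> sZ; rewrite leibniz// (tangent_deriv_locally_cst _ oU Up f1).
  by rewrite scale0r add0r f1// scale1r.
rewrite -(fE _ sX) -(fE _ sY); congr (nabla p v _); apply/funext => q.
have [Uq|Uq] := pselect (U q); first by rewrite XY.
by rewrite /f indicE memNset// !scale0r.
Qed.

Lemma connection0r p v : nabla p v (fun=> 0) = 0.
Proof.
have [_ nD _ _] := nablaC.
have := nD p v _ _ (smooth_field_at0 p) (smooth_field_at0 p).
rewrite (_ : (fun q => _) = fun=> 0); last by apply/funext => q; rewrite addr0.
by move/eqP; rewrite -subr_eq0 opprD addrA subrr sub0r oppr_eq0 => /eqP.
Qed.

Lemma connection0l p Y : smooth_field_at M p Y -> nabla p 0 Y = 0.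
Proof.
move=> sY; have [nl _ _ _] := nablaC.
have := nl p Y sY 0 0 0; rewrite scale0r addr0 => ->.
by rewrite scale0r add0r; have := nl p Y sY (-1) 0 0;
   rewrite scaler0 addr0 scaleN1r addNr.
Qed.

Lemma smooth_cov p X Y : smooth_field_at M p X -> smooth_field_at M p Y ->
  smooth_field_at M p (cov nabla X Y).
Proof.
move=> sX sY; have [_ _ _ sC] := nablaC.
have [U [oU Up sXU sYU]] := smooth_field_atI sX sY.
by exists U; split=> //; exact: sC.
Qed.

(** Away from the open set where [Z] is smooth, [cov nabla (fun=> 0) Z] may be junk; it vanishes
    near [p] only, and locality replaces it by the zero field. *)
Lemma connection_cov0 p v Z : smooth_field_at M p Z ->
  nabla p v (cov nabla (fun=> 0) Z) = 0.
Proof.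
move=> [V [oV Vp sZ]]; apply: etrans (connection0r p v); apply: esym.
apply: (connection_local _ oV Vp) (smooth_field_at0 p) => q Vq.
by rewrite /cov connection0l//; exists V.
Qed.

Hypothesis tf : torsion_free M nabla.

(** This trades brackets for covariant derivatives, so that brackets of product fields need no
    computation in coordinates. *)
Lemma lie_bracketE p X Y : smooth_field_at M p X -> smooth_field_at M p Y ->
  lie_bracket M X Y p = cov nabla X Y p - cov nabla Y X p.
Proof. by move=> sX sY; have /subr0_eq -> := tf sX sY. Qed.

(** Each of the three terms vanishes. Together with [curvature0r] this kills the curvature on mixed
    pairs: on each factor, one of the first two arguments is the zero field. *)
Lemma curvature0l p Y Z : smooth_field_at M p Y -> smooth_field_at M p Z ->
  curvature M nabla (fun=> 0) Y Z p = 0.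
Proof.
move=> sY sZ.
have s0 := smooth_field_at0 p.
rewrite /curvature {1 3}/cov connection_cov0//.
rewrite connection0l//; last exact: smooth_cov.
rewrite {1}/cov lie_bracketE// /cov connection0r connection0l// subr0.
by rewrite connection0l// !subr0.
Qed.

Lemma curvature0r p X Z : smooth_field_at M p X -> smooth_field_at M p Z ->
  curvature M nabla X (fun=> 0) Z p = 0.
Proof.
move=> sX sZ.
have s0 := smooth_field_at0 p.
rewrite /curvature {1 3}/cov connection_cov0//.
rewrite connection0l//; last exact: smooth_cov.
rewrite {1}/cov lie_bracketE// /cov connection0r connection0l// subr0.
by rewrite connection0l// !subr0.
Qed.

End Connection.
End Atlas.
End SmoothAtlas.

(** * Product charts, product fields and R = R1 + R2 *)

Section ProductAtlas.
Local Open Scope classical_set_scope.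
Local Open Scope ring_scope.

Lemma open_prod_set (T1 T2 : topologicalType) (A : set T1) (B : set T2) :
  open A -> open B -> open (A `*` B).
Proof.
move=> oA oB; have -> : A `*` B = (fst @^-1` A) `&` (snd @^-1` B) by [].
apply: openI; first by apply: open_comp => // x _; exact: cvg_fst.
by apply: open_comp => // x _; exact: cvg_snd.
Qed.

Context (R : realType) (m1 m2 : nat) (T1 T2 : topologicalType).
Context (M1 : atlas R m1 T1) (M2 : atlas R m2 T2).
Hypotheses (sM1 : smooth_atlas M1) (sM2 : smooth_atlas M2).
Local Notation M := (prod_atlas M1 M2).

Lemma prod_chart_image (i : chart M) U1 U2 :
  chart_image i (U1 `*` U2) = block_set (chart_image i.1 U1) (chart_image i.2 U2).
Proof.
apply/seteqP; split=> x.
  move=> [q [[d1 d2] [u1 u2]] <-]; split; rewrite /= ?row_mxKl ?row_mxKr.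
    by exists q.1.
  by exists q.2.
move=> [[q1 [d1 u1] E1] [q2 [d2 u2] E2]]; exists (q1, q2) => //=.
by rewrite E1 E2 hsubmxK.
Qed.

Lemma prod_smooth_atlas : smooth_atlas M.
Proof.
have setTE : [set: T1 * T2] = setT `*` setT by apply/seteqP; split.
split.
- by move=> i; apply: open_prod_set; exact: atlas_dom_open.
- by move=> p; split; exact: atlas_dom_chart_at.
- move=> i; rewrite setTE prod_chart_image.
  by apply: open_block_set; exact: atlas_chart_image_open.
- move=> i p [d1 d2] /=; rewrite row_mxKl row_mxKr.
  by rewrite !atlas_coordK//; case: p d1 d2.
- move=> i p [d1 d2].
  have -> : @coord R (m1 + m2) (T1 * T2)%type M i = (fun p =>
      row_inl m2 (@coord R m1 T1 M1 i.1 p.1)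
      + row_inr m1 (@coord R m2 T2 M2 i.2 p.2)).
    by apply/funext => q; rewrite -row_mxE_inlr.
  apply: cvgD.
    apply: continuous_comp; last exact: rV_linear_continuous.
    apply: continuous_comp; first exact: cvg_fst.
    exact: atlas_coord_continuous.
  apply: continuous_comp; last exact: rV_linear_continuous.
  apply: continuous_comp; first exact: cvg_snd.
  exact: atlas_coord_continuous.
- move=> i x; rewrite setTE prod_chart_image => -[x1 x2].
  have c1 : {for x, continuous (@param R m1 T1 M1 i.1 \o lsubmx)}.
    apply: continuous_comp; first exact: continuous_lsubmx.
    exact: atlas_param_continuous.
  have c2 : {for x, continuous (@param R m2 T2 M2 i.2 \o rsubmx)}.
    apply: continuous_comp; first exact: continuous_rsubmx.
    exact: atlas_param_continuous.
  exact: cvg_pair c1 c2.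
- move=> i j k; rewrite /= prod_chart_image.
  (* The transition between product charts unfolds to the block map of the transitions of the
     factors. *)
  apply: (is_Ck_block (f := transition i.1 j.1) (g := transition i.2 j.2)).
  + by apply: chart_image_sub_open => //; exact: atlas_dom_open.
  + by apply: chart_image_sub_open => //; exact: atlas_dom_open.
  + exact: atlas_transition_smooth.
  + exact: atlas_transition_smooth.
Qed.

(** The differential of a product transition is block diagonal, so in any product chart the
    coordinates of X1 + X2 form the block map of the coordinates of X1 and X2. *)
Lemma smooth_prod_field U1 U2 X1 X2 : open U1 -> open U2 ->
  smooth_field M1 U1 X1 -> smooth_field M2 U2 X2 ->
  smooth_field M (U1 `*` U2) (prod_field X1 X2).
Proof.
move=> o1 o2 s1 s2 i k; rewrite prod_chart_image.
have oc1 := chart_image_sub_open sM1 (i := i.1) o1.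
have oc2 := chart_image_sub_open sM2 (i := i.2) o2.
apply: eq_is_Ck (is_Ck_block oc1 oc2 (s1 i.1 k) (s2 i.2 k)).
  exact: open_block_set.
move=> x [/(chart_image_param sM1) [d1 _ _] /(chart_image_param sM2) [d2 _ _]].
set q1 := param i.1 (lsubmx x) in d1; set q2 := param i.2 (rsubmx x) in d2.
have D1 := differentiable_transition sM1 (atlas_dom_chart_at sM1 q1) d1.
have D2 := differentiable_transition sM2 (atlas_dom_chart_at sM2 q2) d2.
have [] := diff_block (f := transition (chart_at M1 q1) i.1)
  (g := transition (chart_at M2 q2) i.2)
  (x := row_mx (coord (chart_at M1 q1) q1) (coord (chart_at M2 q2) q2)).
- by rewrite row_mxKl.
- by rewrite row_mxKr.
move=> _ E; apply: esym.
apply: (etrans (congr1 (@^~ (row_mx (X1 q1) (X2 q2))) E)).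
by rewrite /block_fun !row_mxKl !row_mxKr.
Qed.

Lemma smooth_prod_field_at p X1 X2 :
  smooth_field_at M1 p.1 X1 -> smooth_field_at M2 p.2 X2 ->
  smooth_field_at M p (prod_field X1 X2).
Proof.
move=> [U1 [ o1 u1 s1]] [U2 [ o2 u2 s2]]; exists (U1 `*` U2); split=> //.
  exact: open_prod_set.
exact: smooth_prod_field.
Qed.

Context (nabla1 : T1 -> 'rV[R]_m1 -> (T1 -> 'rV[R]_m1) -> 'rV[R]_m1)
  (nabla2 : T2 -> 'rV[R]_m2 -> (T2 -> 'rV[R]_m2) -> 'rV[R]_m2)
  (nabla : T1 * T2 -> 'rV[R]_(m1 + m2) ->
           (T1 * T2 -> 'rV[R]_(m1 + m2)) -> 'rV[R]_(m1 + m2)).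
Hypotheses (lc1 : linear_connection M1 nabla1) (tf1 : torsion_free M1 nabla1)
  (lc2 : linear_connection M2 nabla2) (tf2 : torsion_free M2 nabla2)
  (lc : linear_connection M nabla) (tf : torsion_free M nabla).
Hypothesis nablaE : product_connection M1 M2 nabla1 nabla2 nabla.

Lemma prod_covE p X1 X2 Y1 Y2 :
  smooth_field_at M1 p.1 Y1 -> smooth_field_at M2 p.2 Y2 ->
  cov nabla (prod_field X1 X2) (prod_field Y1 Y2) p =
  prod_field (cov nabla1 X1 Y1) (cov nabla2 X2 Y2) p.
Proof.
by move=> s1 s2; rewrite /cov nablaE// /prod_field row_mxKl row_mxKr.
Qed.

(** [product_connection] applies to product fields, and the inner covariant derivative is known to
    be one only where [Y1] and [Y2] are smooth; [connection_local] makes this enough for the outer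
    derivative. *)
Lemma prod_cov2E p v X1 X2 Y1 Y2 :
  smooth_field_at M1 p.1 X1 -> smooth_field_at M2 p.2 X2 ->
  smooth_field_at M1 p.1 Y1 -> smooth_field_at M2 p.2 Y2 ->
  nabla p v (cov nabla (prod_field X1 X2) (prod_field Y1 Y2)) =
  row_mx (nabla1 p.1 (lsubmx v) (cov nabla1 X1 Y1))
         (nabla2 p.2 (rsubmx v) (cov nabla2 X2 Y2)).
Proof.
move=> sX1 sX2 sY1 sY2.
have sC1 := smooth_cov lc1 sX1 sY1.
have sC2 := smooth_cov lc2 sX2 sY2.
rewrite -(nablaE _ sC1 sC2); apply: esym.
have [U1 [ o1 u1 s1]] := sY1; have [U2 [ o2 u2 s2]] := sY2.
apply: (connection_local prod_smooth_atlas lc v (open_prod_set o1 o2)) => //.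
  move=> q [q1 q2]; apply: esym; apply: prod_covE; first by exists U1.
  by exists U2.
exact: smooth_prod_field_at.
Qed.

Lemma prod_curvatureE p X1 X2 Y1 Y2 Z1 Z2 :
  smooth_field_at M1 p.1 X1 -> smooth_field_at M2 p.2 X2 ->
  smooth_field_at M1 p.1 Y1 -> smooth_field_at M2 p.2 Y2 ->
  smooth_field_at M1 p.1 Z1 -> smooth_field_at M2 p.2 Z2 ->
  curvature M nabla (prod_field X1 X2) (prod_field Y1 Y2) (prod_field Z1 Z2) p =
  row_mx (curvature M1 nabla1 X1 Y1 Z1 p.1) (curvature M2 nabla2 X2 Y2 Z2 p.2).
Proof.
move=> sX1 sX2 sY1 sY2 sZ1 sZ2.
have sX := smooth_prod_field_at sX1 sX2.
have sY := smooth_prod_field_at sY1 sY2.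
rewrite /curvature {1 3 5}/cov !prod_cov2E// nablaE//.
(* The bracket on the product is split through torsion-freeness upstairs, then recombined through
   torsion-freeness of each factor. *)
rewrite (lie_bracketE tf)// !prod_covE// /prod_field.
rewrite !row_mxKl !row_mxKr !opp_row_mx !add_row_mx.
by rewrite row_mxKl row_mxKr /cov (lie_bracketE tf1)// (lie_bracketE tf2).
Qed.

End ProductAtlas.

(** * Linear algebra at one point *)

Section Algebra.
Local Open Scope ring_scope.
Context (R : realType).

Section Form.
Context (m : nat) (w : 'rV[R]_m -> 'rV[R]_m -> R).
Hypothesis wlin : forall u, scalar (w u) /\ scalar (w ^~ u).
Hypothesis walt : forall u, w u u = 0.
Hypothesis wnd : forall u, (forall v, w u v = 0) -> u = 0.

Lemma bil_linr u a x y : w u (a *: x + y) = a * w u x + w u y.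
Proof. by have [l _] := wlin u; have := l a x y. Qed.

Lemma bil_linl u a x y : w (a *: x + y) u = a * w x u + w y u.
Proof. by have [_ l] := wlin u; have := l a x y. Qed.

Lemma bil0r u : w u 0 = 0.
Proof.
by have := bil_linr u (-1) 0 0; rewrite scaler0 addr0 mulN1r addNr.
Qed.

Lemma bil0l u : w 0 u = 0.
Proof.
by have := bil_linl u (-1) 0 0; rewrite scaler0 addr0 mulN1r addNr.
Qed.

Lemma bilDr u x y : w u (x + y) = w u x + w u y.
Proof. by rewrite -[x]scale1r bil_linr mul1r scale1r. Qed.

Lemma bilDl u x y : w (x + y) u = w x u + w y u.
Proof. by rewrite -[x]scale1r bil_linl mul1r scale1r. Qed.

Lemma bilZr u a x : w u (a *: x) = a * w u x.
Proof. by rewrite -[_ *: _]addr0 bil_linr bil0r addr0. Qed.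

Lemma bilZl u a x : w (a *: x) u = a * w x u.
Proof. by rewrite -[_ *: _]addr0 bil_linl bil0l addr0. Qed.

Lemma bil_skew x y : w x y = - w y x.
Proof.
have := walt (x + y); rewrite bilDl !bilDr !walt addr0 add0r.
by move/eqP; rewrite addr_eq0 => /eqP.
Qed.

Lemma bil_ndr x y : (forall v, w v x = w v y) -> x = y.
Proof.
move=> xy; apply/eqP; rewrite -subr_eq0; apply/eqP/wnd => v.
by rewrite bil_skew bilDr -(scaleN1r y) bilZr xy mulN1r subrr oppr0.
Qed.

Lemma bil_dual u : u != 0 -> exists v, w u v = 1.
Proof.
move=> u0; apply: contrapT => H; move/eqP: u0; apply; apply: wnd => v.
apply/eqP/negP => /negP wuv; apply: H; exists ((w u v)^-1 *: v).
by rewrite bilZr mulVf.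
Qed.

Lemma bil_sumr x (u : 'rV[R]_m) :
  \sum_j w x (delta_mx 0 j) * u 0 j = w x u.
Proof.
rewrite [in RHS](row_sum_delta u).
elim: (index_enum _) => [|j s IH]; first by rewrite !big_nil bil0r.
by rewrite !big_cons bilDr bilZr IH mulrC.
Qed.

Lemma bil_suml y (u : 'rV[R]_m) :
  \sum_j w (delta_mx 0 j) y * u 0 j = w u y.
Proof.
rewrite [in RHS](row_sum_delta u).
elim: (index_enum _) => [|j s IH]; first by rewrite !big_nil bil0l.
by rewrite !big_cons bilDl bilZl IH mulrC.
Qed.

End Form.

Lemma rV_neq0 m : (0 < m)%N -> exists u : 'rV[R]_m, u != 0.
Proof.
case: m => // m _; exists (delta_mx 0 0); apply/eqP => /matrixP /(_ 0 0) /eqP.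
by rewrite !mxE !eqxx oner_eq0.
Qed.

Context (m1 m2 : nat) (m1_gt0 : (0 < m1)%N) (m2_gt0 : (0 < m2)%N).
Context (w1 : 'rV[R]_m1 -> 'rV[R]_m1 -> R) (w2 : 'rV[R]_m2 -> 'rV[R]_m2 -> R).
Hypotheses (wlin1 : forall u, scalar (w1 u) /\ scalar (w1 ^~ u))
  (walt1 : forall u, w1 u u = 0)
  (wnd1 : forall u, (forall v, w1 u v = 0) -> u = 0)
  (wlin2 : forall u, scalar (w2 u) /\ scalar (w2 ^~ u))
  (walt2 : forall u, w2 u u = 0)
  (wnd2 : forall u, (forall v, w2 u v = 0) -> u = 0).

Let w (u v : 'rV[R]_(m1 + m2)) : R :=
  w1 (lsubmx u) (lsubmx v) + w2 (rsubmx u) (rsubmx v).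

Lemma sum_form_linear u : scalar (w u) /\ scalar (w ^~ u).
Proof.
split=> a x y; rewrite /w !linearP /=.
  by rewrite (bil_linr wlin1) (bil_linr wlin2) mulrDr addrACA.
by rewrite (bil_linl wlin1) (bil_linl wlin2) mulrDr addrACA.
Qed.

Lemma sum_form_alternating u : w u u = 0.
Proof. by rewrite /w walt1 walt2 addr0. Qed.

Lemma sum_form_nondegenerate u : (forall v, w u v = 0) -> u = 0.
Proof.
move=> wu0; rewrite -[u]hsubmxK.
rewrite (wnd1 (u := lsubmx u)); last first.
  move=> v; have := wu0 (row_mx v 0); rewrite /w row_mxKl row_mxKr.
  by rewrite (bil0r wlin2) addr0.
rewrite (wnd2 (u := rsubmx u)) ?row_mx0// => v.
by have := wu0 (row_mx 0 v); rewrite /w row_mxKl row_mxKr (bil0r wlin1) add0r.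
Qed.

(** The hypothesis is the Ricci bracket on a mixed pair, where [w X Y = 0] removes its first term.
    Since [A] may fail to be additive, its values on the two factors do not determine it; the free
    argument [z] and nondegeneracy recover [A z] for every [z]. *)
Lemma mixed_bracket_scalar (A : 'rV[R]_(m1 + m2) -> 'rV[R]_(m1 + m2)) :
  (forall x y z, let X := row_mx x 0 in let Y := row_mx 0 y in
     w X z *: A Y - w Y (A z) *: X - w Y z *: A X + w X (A z) *: Y = 0) ->
  exists l, forall z, A z = row_mx (l *: lsubmx z) (- l *: rsubmx z).
Proof.
move=> H.
have C1 x y z : w1 x (lsubmx z) *: lsubmx (A (row_mx 0 y))
    - w2 y (rsubmx (A z)) *: x
    - w2 y (rsubmx z) *: lsubmx (A (row_mx x 0)) = 0.
  have /(congr1 lsubmx) := H x y z.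
  rewrite /= /w !row_mxKl !row_mxKr !(bil0l wlin1) !(bil0l wlin2) !addr0 !add0r.
  by rewrite !linearD /= !linearN /= !linearZ /= !row_mxKl scaler0 addr0 linear0.
have C2 x y z : w1 x (lsubmx z) *: rsubmx (A (row_mx 0 y))
    - w2 y (rsubmx z) *: rsubmx (A (row_mx x 0))
    + w1 x (lsubmx (A z)) *: y = 0.
  have /(congr1 rsubmx) := H x y z.
  rewrite /= /w !row_mxKl !row_mxKr !(bil0l wlin1) !(bil0l wlin2) !addr0 !add0r.
  by rewrite !linearD /= !linearN /= !linearZ /= !row_mxKr oppr0 scaler0 addr0 linear0.
have [x0 x0n] := rV_neq0 m1_gt0; have [y0 y0n] := rV_neq0 m2_gt0.
have [z0 xz] := bil_dual wlin1 wnd1 x0n.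
have [t0 yt] := bil_dual wlin2 wnd2 y0n.
(* [mu] and [l] are read off [C2] and [C1] when [z] is dual to [x0] or to [y0]: one coefficient
   becomes 1 and another 0. *)
pose mu := - w1 x0 (lsubmx (A (row_mx z0 0))).
pose l := - w2 y0 (rsubmx (A (row_mx 0 t0))).
have A2 y : rsubmx (A (row_mx 0 y)) = mu *: y.
  have := C2 x0 y (row_mx z0 0); rewrite row_mxKl row_mxKr xz scale1r.
  rewrite (bil0r wlin2) scale0r subr0 => /eqP.
  by rewrite addr_eq0 -scaleNr => /eqP.
have A1 x : lsubmx (A (row_mx x 0)) = l *: x.
  have := C1 x y0 (row_mx 0 t0); rewrite row_mxKl row_mxKr yt scale1r.
  rewrite (bil0r wlin1) scale0r sub0r => /eqP.
  by rewrite subr_eq0 -scaleNr => /eqP ->.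
have A12 x : rsubmx (A (row_mx x 0)) = w1 x (lsubmx (A (row_mx 0 t0))) *: y0.
  have := C2 x y0 (row_mx 0 t0); rewrite row_mxKl row_mxKr yt scale1r.
  by rewrite (bil0r wlin1) scale0r sub0r addrC => /eqP; rewrite subr_eq0 => /eqP.
have A21 y : lsubmx (A (row_mx 0 y)) = w2 y (rsubmx (A (row_mx z0 0))) *: x0.
  have := C1 x0 y (row_mx z0 0); rewrite row_mxKl row_mxKr xz scale1r.
  by rewrite (bil0r wlin2) scale0r subr0 => /eqP; rewrite subr_eq0 => /eqP.
have A12_0 : rsubmx (A (row_mx z0 0)) = 0.
  apply: wnd2 => y; rewrite (bil_skew wlin2 walt2).
  (* Using [z0] both as [x] and as the left half of [z] makes the first coefficient vanish by
     alternation; only a multiple of [z0] remains, and [z0] is nonzero because it pairs to 1 with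
     [x0]. *)
  have := C1 z0 y (row_mx z0 0); rewrite row_mxKl row_mxKr walt1 scale0r sub0r.
  rewrite (bil0r wlin2) scale0r subr0 => /eqP; rewrite oppr_eq0 scaler_eq0.
  case/orP => [/eqP ->|/eqP z00]; first by rewrite oppr0.
  by move: xz; rewrite z00 (bil0r wlin1) => /eqP; rewrite eq_sym oner_eq0.
have A21_0 y : lsubmx (A (row_mx 0 y)) = 0.
  by rewrite A21 A12_0 (bil0r wlin2) scale0r.
have A12_0' x : rsubmx (A (row_mx x 0)) = 0.
  by rewrite A12 A21_0 (bil0r wlin1) scale0r.
(* With the off-diagonal parts gone, [C1] is a multiple of [x0] for every [z]; its coefficient fixes
   the pairing of [rsubmx (A z)] with each [y]. *)
have Ar z : rsubmx (A z) = - l *: rsubmx z.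
  apply: (bil_ndr wlin2 walt2 wnd2) => y.
  have := C1 x0 y z; rewrite A21_0 scaler0 sub0r A1 scalerA -opprD -scalerDl.
  move/eqP; rewrite oppr_eq0 scaler_eq0 (negPf x0n) orbF addr_eq0 => /eqP ->.
  by rewrite (bilZr wlin2) mulNr mulrC.
have Al z : lsubmx (A z) = - mu *: lsubmx z.
  apply: (bil_ndr wlin1 walt1 wnd1) => x.
  have := C2 x y0 z; rewrite A12_0' scaler0 subr0 A2 scalerA -scalerDl.
  move/eqP; rewrite scaler_eq0 (negPf y0n) orbF addrC addr_eq0 => /eqP ->.
  by rewrite (bilZr wlin1) mulNr mulrC.
(* The left half of [A (row_mx x0 0)] has now been computed twice. *)
have lmu : l = - mu.
  have := Al (row_mx x0 0); rewrite A1 row_mxKl => /eqP.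
  by rewrite -subr_eq0 -scalerBl scaler_eq0 (negPf x0n) orbF subr_eq0 => /eqP.
by exists l => z; rewrite -Ar lmu -Al hsubmxK.
Qed.

(** The three rank-one terms have traces 2, -1 and -1 times w(x, Ay) and cancel; what survives is
    w(x, y) tr(A) and w(x, Ay) times the trace of the identity. *)
Lemma trace_bracket (A : 'rV[R]_(m1 + m2) -> 'rV[R]_(m1 + m2)) l c x y
    (f : 'rV[R]_(m1 + m2) -> 'rV[R]_(m1 + m2)) :
  (forall z, A z = row_mx (l *: lsubmx z) (- l *: rsubmx z)) ->
  (forall z, f z = c *: (2 * w x z *: A y + w x y *: A z - w z (A y) *: x
     - w z y *: A x + w x (A y) *: z)) ->
  \tr (lin1_mx f) =
    w x (c *: ((m1 + m2)%:R *: A y + (l * (m1%:R - m2%:R)) *: y)).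
Proof.
move=> AE fE; have wl := sum_form_linear.
have trA : \sum_j A (delta_mx 0 j) 0 j = l * (m1%:R - m2%:R).
  rewrite big_split_ord /= (eq_bigr (fun=> l)); last first.
    by move=> i _; rewrite AE row_mxEl !mxE !eqxx mulr1.
  rewrite [X in _ + X](eq_bigr (fun=> - l)); last first.
    by move=> i _; rewrite AE row_mxEr !mxE !eqxx mulr1.
  by rewrite !sumr_const !card_ord mulrBr !mulr_natr mulNrn.
have trI : \sum_j (delta_mx 0 j : 'rV[R]_(m1 + m2)) 0 j = (m1 + m2)%:R.
  rewrite (eq_bigr (fun=> 1)); first by rewrite sumr_const card_ord.
  by move=> i _; rewrite mxE !eqxx.
(* Self-adjointness, specific to the block form; a skew [A] would give the opposite sign and spoil
   the cancellation. *)
have wA : w (A x) y = w x (A y).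
  rewrite !AE /w !row_mxKl !row_mxKr (bilZl wlin1) (bilZl wlin2).
  by rewrite (bilZr wlin1) (bilZr wlin2).
rewrite /mxtrace.
rewrite (eq_bigr (fun j => c * (2 * (w x (delta_mx 0 j) * A y 0 j)
    + w x y * A (delta_mx 0 j) 0 j - w (delta_mx 0 j) (A y) * x 0 j
    - w (delta_mx 0 j) y * A x 0 j
    + w x (A y) * (delta_mx 0 j : 'rV[R]_(m1 + m2)) 0 j))); last first.
  by move=> j _; rewrite [LHS]mxE fE !mxE mulrA.
rewrite -mulr_sumr !big_split /= !sumrN -!mulr_sumr.
rewrite (bil_sumr wl) !(bil_suml wl) trA trI wA.
rewrite (bilZr wl) (bilDr wl) !(bilZr wl); congr (c * _).
rewrite mulrDl mul1r; ring.
Qed.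

(** The eigenvalues l and -l meet the common term l(m1 - m2) with opposite relative signs, so
    testing the equation on each factor gives two distinct conditions on [l]. *)
Lemma block_scalar_eq0 l (A : 'rV[R]_(m1 + m2) -> 'rV[R]_(m1 + m2)) :
  (forall z, A z = row_mx (l *: lsubmx z) (- l *: rsubmx z)) ->
  (forall y, A y = (2 * ((m1 + m2)./2%:R + 1))^-1 *:
     ((m1 + m2)%:R *: A y + (l * (m1%:R - m2%:R)) *: y)) ->
  forall y, A y = 0.
Proof.
move=> AE AE2.
suff l0 : l = 0 by move=> y; rewrite AE l0 oppr0 !scale0r row_mx0.
have [x0 x0n] := rV_neq0 m1_gt0; have [y0 y0n] := rV_neq0 m2_gt0.
set h := (m1 + m2)./2 in AE2.
have h0 : 2 * (h%:R + 1) != 0 :> R.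
  by rewrite mulf_neq0// ?pnatr_eq0// -natr1 pnatr_eq0.
apply/eqP/negPn/negP => l0.
have E1 : 2 * (h%:R + 1) * l = (m1 + m2)%:R * l + l * (m1%:R - m2%:R).
  have /(congr1 lsubmx) := AE2 (row_mx x0 0).
  rewrite AE linearZ linearD /= !linearZ /= !row_mxKl scalerA -scalerDl scalerA.
  move/eqP; rewrite -subr_eq0 -scalerBl scaler_eq0 (negPf x0n) orbF subr_eq0.
  by move=> /eqP {1}->; rewrite mulrA mulfV// mul1r.
have E2 : 2 * (h%:R + 1) * l = (m1 + m2)%:R * l - l * (m1%:R - m2%:R).
  have := congr1 rsubmx (AE2 (row_mx 0 y0)).
  rewrite AE linearZ linearD /= !linearZ /= !row_mxKr scalerA -scalerDl scalerA.
  move/eqP; rewrite -subr_eq0 -scalerBl scaler_eq0 (negPf y0n) orbF subr_eq0.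
  move=> /eqP e; apply: oppr_inj; rewrite -[LHS]mulrN e mulrA mulfV// mul1r.
  rewrite -[l *: _]/(l * _); ring.
have F1 : (h%:R + 1 : R) = m1%:R.
  by apply: (mulIf l0); move: E1; rewrite natrD; lra.
have F2 : (h%:R + 1 : R) = m2%:R.
  by apply: (mulIf l0); move: E2; rewrite natrD; lra.
move/eqP: F1; move/eqP: F2; rewrite natr1 !eqr_nat => /eqP E4 /eqP E3.
by move: E3 E4; rewrite /h; lia.
Qed.

End Algebra.

(** * Vanishing of the Ricci endomorphism, and flatness *)

Section WeylZero.
Local Open Scope classical_set_scope.
Local Open Scope ring_scope.
Context (R : realType) (m1 m2 : nat) (T1 T2 : topologicalType).
Context (M1 : atlas R m1 T1) (M2 : atlas R m2 T2).
Context (w1 : T1 -> 'rV[R]_m1 -> 'rV[R]_m1 -> R)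
  (w2 : T2 -> 'rV[R]_m2 -> 'rV[R]_m2 -> R).
Context (nabla1 : T1 -> 'rV[R]_m1 -> (T1 -> 'rV[R]_m1) -> 'rV[R]_m1)
  (nabla2 : T2 -> 'rV[R]_m2 -> (T2 -> 'rV[R]_m2) -> 'rV[R]_m2)
  (nabla : T1 * T2 -> 'rV[R]_(m1 + m2) ->
           (T1 * T2 -> 'rV[R]_(m1 + m2)) -> 'rV[R]_(m1 + m2)).
Hypotheses (m1_gt0 : (0 < m1)%N) (m2_gt0 : (0 < m2)%N).
Hypotheses (sM1 : smooth_atlas M1) (sM2 : smooth_atlas M2).
Hypotheses (sw1 : symplectic_form M1 w1) (sw2 : symplectic_form M2 w2).
Hypotheses (lc1 : linear_connection M1 nabla1) (tf1 : torsion_free M1 nabla1)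
  (lc2 : linear_connection M2 nabla2) (tf2 : torsion_free M2 nabla2).
Local Notation M := (prod_atlas M1 M2).
Local Notation w := (prod_form w1 w2).
Hypotheses (lc : linear_connection M nabla) (tf : torsion_free M nabla).
Hypothesis nablaE : product_connection M1 M2 nabla1 nabla2 nabla.
Hypothesis W0 : weyl_zero M nabla w.

Let c : R := (2 * ((m1 + m2)./2%:R + 1))^-1.

Lemma weyl_zero_curvature p X Y Z (A := ricci_endo M nabla w p) :
  smooth_field_at M p X -> smooth_field_at M p Y -> smooth_field_at M p Z ->
  curvature M nabla X Y Z p = c *:
      (2 * w p (X p) (Y p) *: A (Z p) + w p (X p) (Z p) *: A (Y p)
       - w p (Y p) (A (Z p)) *: X p
       - w p (Y p) (Z p) *: A (X p) + w p (X p) (A (Z p)) *: Y p).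
Proof. by move=> sX sY sZ; have /subr0_eq := W0 sX sY sZ. Qed.

Lemma ricci_endo_eq0 p y : ricci_endo M nabla w p y = 0.
Proof.
have [wlin1 walt1 wnd1 _ _] := sw1; have [wlin2 walt2 wnd2 _ _] := sw2.
have {}wlin1 := wlin1 p.1; have {}walt1 := walt1 p.1; have {}wnd1 := wnd1 p.1.
have {}wlin2 := wlin2 p.2; have {}walt2 := walt2 p.2; have {}wnd2 := wnd2 p.2.
have sM := prod_smooth_atlas sM1 sM2.
set A := ricci_endo M nabla w p.
have c0 : c != 0.
  by rewrite invr_eq0 mulf_neq0// ?pnatr_eq0// natr1 pnatr_eq0.
have [l AE] : exists l, forall z, A z = row_mx (l *: lsubmx z) (- l *: rsubmx z).
  apply: (mixed_bracket_scalar m1_gt0 m2_gt0 wlin1 walt1 wnd1 wlin2 walt2 wnd2).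
  move=> x y' z X Y.
  (* The test fields are product fields: [x] extended on the first factor plus zero, zero plus [y']
     extended on the second, and the two halves of [z] extended separately. *)
  have sx := smooth_extend_vec sM1 p.1 x; have sy := smooth_extend_vec sM2 p.2 y'.
  have sz1 := smooth_extend_vec sM1 p.1 (lsubmx z).
  have sz2 := smooth_extend_vec sM2 p.2 (rsubmx z).
  have s01 := smooth_field_at0 M1 p.1; have s02 := smooth_field_at0 M2 p.2.
  have XY0 : w p X Y = 0.
    rewrite /prod_form row_mxKl row_mxKl !row_mxKr.
    by rewrite (bil0r wlin1) (bil0l wlin2) addr0.
  have := prod_curvatureE sM1 sM2 lc1 tf1 lc2 tf2 lc tf nablaE
    sx s02 s01 sy sz1 sz2.
  rewrite (curvature0r sM1 lc1 tf1 sx sz1) (curvature0l sM2 lc2 tf2 sy sz2) row_mx0.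
  rewrite weyl_zero_curvature; try exact: smooth_prod_field_at.
  rewrite /prod_field !extend_vec_self// hsubmxK -/A => /eqP.
  rewrite scaler_eq0 (negPf c0) /= => /eqP; apply: etrans.
  by rewrite -/X -/Y XY0 mulr0 scale0r add0r.
suff AE2 x : A x = c *: ((m1 + m2)%:R *: A x + (l * (m1%:R - m2%:R)) *: x).
  exact: block_scalar_eq0 AE AE2 y.
have wlin := sum_form_linear wlin1 wlin2.
have walt := sum_form_alternating walt1 walt2.
have wnd := sum_form_nondegenerate wlin1 wnd1 wlin2 wnd2.
(* The trace variable occupies the second slot of the curvature, so the bracket is taken at [u],
   [z], [v], as in [trace_bracket]. *)
have ricciE u v : ricci M nabla p u v =
    w p u (c *: ((m1 + m2)%:R *: A v + (l * (m1%:R - m2%:R)) *: v)).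
  apply: (trace_bracket wlin1 wlin2 AE) => z.
  rewrite /curvature_at weyl_zero_curvature; try exact: smooth_extend_vec.
  by rewrite !extend_vec_self.
apply: (bil_ndr wlin walt wnd) => v.
(* The trace formula supplies the witness; from here on the value of [get] really represents the
   Ricci tensor, and nondegeneracy equates it with the witness. *)
have ex : exists a, [set a | forall u, ricci M nabla p u x = w p u a] a.
  by exists (c *: ((m1 + m2)%:R *: A x + (l * (m1%:R - m2%:R)) *: x)).
have /(_ v) := getPex ex; rewrite ricciE; exact: esym.
Qed.

(** Every term of the bracket contains a value of [A], and the bracket computes the curvature of
    arbitrary smooth fields, not just of product ones. *)
Lemma weyl_zero_flat : flat M nabla.
Proof.
move=> p X Y Z sX sY sZ; rewrite weyl_zero_curvature// !ricci_endo_eq0.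
have w0 u : w p u 0 = 0.
  have [wlin1 _ _ _ _] := sw1; have [wlin2 _ _ _ _] := sw2.
  exact: bil0r (sum_form_linear (wlin1 p.1) (wlin2 p.2)) u.
by rewrite !w0 !scaler0 !scale0r !(addr0, subr0) scaler0.
Qed.

(** Fields on the first factor are extended by the zero field of the second; a point [q] there is
    needed to place [p] in the product. *)
Lemma flat_factor1 : [set: T2] !=set0 -> flat M1 nabla1.
Proof.
move=> [q _] p X Y Z sX sY sZ.
have s0 := smooth_field_at0 M2 q.
have s0' := smooth_prod_field_at sM1 sM2 (p := (p, q)).
have := prod_curvatureE sM1 sM2 lc1 tf1 lc2 tf2 lc tf nablaE (p := (p, q))
  sX s0 sY s0 sZ s0.
rewrite weyl_zero_flat; try exact: s0'.
by move/(congr1 lsubmx); rewrite row_mxKl linear0.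
Qed.

Lemma flat_factor2 : [set: T1] !=set0 -> flat M2 nabla2.
Proof.
move=> [q _] p X Y Z sX sY sZ.
have s0 := smooth_field_at0 M1 q.
have s0' := smooth_prod_field_at sM1 sM2 (p := (q, p)).
have := prod_curvatureE sM1 sM2 lc1 tf1 lc2 tf2 lc tf nablaE (p := (q, p))
  s0 sX s0 sY s0 sZ.
rewrite weyl_zero_flat; try exact: s0'.
by move/(congr1 rsubmx); rewrite row_mxKr linear0.
Qed.

End WeylZero.

Theorem theorem1 (R : realType) (m1 m2 : nat) (T1 T2 : topologicalType)
  (M1 : atlas R m1 T1) (M2 : atlas R m2 T2)
  (w1 : T1 -> 'rV[R]_m1 -> 'rV[R]_m1 -> R)
  (w2 : T2 -> 'rV[R]_m2 -> 'rV[R]_m2 -> R)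
  (nabla1 : T1 -> 'rV[R]_m1 -> (T1 -> 'rV[R]_m1) -> 'rV[R]_m1)
  (nabla2 : T2 -> 'rV[R]_m2 -> (T2 -> 'rV[R]_m2) -> 'rV[R]_m2)
  (nabla : T1 * T2 -> 'rV[R]_(m1 + m2) ->
           (T1 * T2 -> 'rV[R]_(m1 + m2)) -> 'rV[R]_(m1 + m2))
  (hm1 : 0 < m1) (hm2 : 0 < m2)
  (hM1 : symplectic_manifold M1 w1) (hM2 : symplectic_manifold M2 w2)
  (hnabla1 : symplectic_connection M1 nabla1 w1)
  (hnabla2 : symplectic_connection M2 nabla2 w2)
  (hnabla : symplectic_connection (prod_atlas M1 M2) nabla (prod_form w1 w2))
  (hprod : product_connection M1 M2 nabla1 nabla2 nabla)
  (hW : weyl_zero (prod_atlas M1 M2) nabla (prod_form w1 w2)) :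
  [/\ flat (prod_atlas M1 M2) nabla, flat M1 nabla1 & flat M2 nabla2].
Proof.
have [mM1 sw1] := hM1; have [mM2 sw2] := hM2.
have [lc1 tf1 _] := hnabla1; have [lc2 tf2 _] := hnabla2.
have [lc tf _] := hnabla.
have sM1 := smooth_manifold_atlas mM1; have sM2 := smooth_manifold_atlas mM2.
split.
- exact: weyl_zero_flat hm1 hm2 sM1 sM2 sw1 sw2 lc1 tf1 lc2 tf2 lc tf hprod hW.
- exact: flat_factor1 hm1 hm2 sM1 sM2 sw1 sw2 lc1 tf1 lc2 tf2 lc tf hprod hW
    (manifold_nonempty mM2).
- exact: flat_factor2 hm1 hm2 sM1 sM2 sw1 sw2 lc1 tf1 lc2 tf2 lc tf hprod hW
    (manifold_nonempty mM1).
Qed.
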